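(* Let $E$ be an arbitrary directed graph and $K$ a field. Then $E$ is the direct limit (in the category $\mathbf{CKGr}$) of its countable CK-subgraphs, and consequently $L_K(E)$ is the direct limit of the algebras $L_K(F)$ over the countable CK-subgraphs $F$ of $E$.
   Context: A (directed) graph $E=(E^0,E^1,r_E,s_E)$ consists of two disjoint sets $E^0$ (vertices), $E^1$ (edges), of arbitrary cardinality, and maps $r_E,s_E:E^1\to E^0$ (range and source). A vertex $v$ is a sink if $s_E^{-1}(v)=\varnothing$, and an infinite emitter if $s_E^{-1}(v)$ is infinite. A graph is countable if its sets of vertices and edges are countable (finite or countably infinite). A graph morphism $\phi:E\to F$ is a pair of maps $\phi^0:E^0\to F^0$, $\phi^1:E^1\to F^1$ with $s_F\phi^1=\phi^0s_E$ and $r_F\phi^1=\phi^0r_E$. It is a CK-morphism if (1) $\phi^0$ and $\phi^1$ are both injective, and (2) for each $v\in E^0$ which is neither a sink nor an infinite emitter, $\phi^1$ induces a bijection $s_E^{-1}(v)\to s_F^{-1}(\phi^0(v))$. $\mathbf{CKGr}$ is the category of all directed graphs with CK-morphisms. A subgraph of $F$ consists of subsets of $F^0$ and $F^1$ closed under taking sources and ranges of the chosen edges, with restricted source and range maps; a CK-subgraph of $F$ is a subgraph whose inclusion map into $F$ is a CK-morphism. The double $\widehat E$ of $E$ has $\widehat E^0=E^0$ and $\widehat E^1=E^1\sqcup\{e^*\mid e\in E^1\}$, with $r(e^* )=s(e)$, $s(e^* )=r(e)$. Paths are written left to right: $e_1e_2\cdots e_n$ with $r(e_i)=s(e_{i+1})$;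 there is also a path $v$ of length zero at each vertex $v$. The path algebra $K\widehat E$ is the $K$-vector space with basis all paths in $\widehat E$, with multiplication given by concatenation when range and source match, and $0$ otherwise. The Leavitt path algebra $L_K(E)$ is the quotient of $K\widehat E$ by the ideal generated by: $e^*e-r(e)$ for all $e\in E^1$; $e^*f$ for all distinct $e,f\in E^1$; and $v-\sum_{e\in E^1,\,s(e)=v}ee^*$ for every $v\in E^0$ which is neither a sink nor an infinite emitter. A CK-morphism $\phi:E\to F$ induces a unique $K$-algebra morphism $L_K(\phi):L_K(E)\to L_K(F)$ with $v\mapsto\phi^0(v)$, $e\mapsto\phi^1(e)$, $e^*\mapsto\phi^1(e)^*$; this makes $L_K$ a functor from $\mathbf{CKGr}$ to the category of (not necessarily unital) $K$-algebras with arbitrary $K$-algebra morphisms. The direct limits are over the set of countable CK-subgraphs of $E$, ordered by inclusion (an upward directed set), with connecting and limit maps the inclusion maps, respectively the maps induced from these by $L_K$. The direct limit is the colimit, in the respective category, over a directed set. *)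

(* Defs.v *)
From HB Require Import structures.
From mathcomp Require Import all_boot all_order all_algebra finmap.
From mathcomp Require Import boolp classical_sets functions cardinality fsbigop.
From mathcomp Require Import monalg.

Set Implicit Arguments.
Unset Strict Implicit.
Unset Printing Implicit Defensive.

Import GRing.Theory.
Local Open Scope classical_set_scope.
Local Open Scope ring_scope.
Local Open Scope quotient_scope.

Record category := Category {
  ob :> Type;
  hom : ob -> ob -> Type;
  idm : forall A, hom A A;
  ccomp : forall A B C, hom B C -> hom A B -> hom A C;
  ccomp1m : forall A B (f : hom A B), ccomp (idm B) f = f;
  ccompm1 : forall A B (f : hom A B), ccomp f (idm A) = f;
  ccompA : forall A B C D (h : hom C D) (g : hom B C) (f : hom A B),
    ccomp h (ccomp g f) = ccomp (ccomp h g) f }.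

Arguments hom {c} _ _.
Arguments idm {c} A.
Arguments ccomp {c A B C} _ _.

Record functor (C D : category) := Functor {
  fob :> C -> D;
  fmap : forall A B : C, hom A B -> hom (fob A) (fob B);
  fmap1 : forall A : C, fmap (idm A) = idm (fob A);
  fmapM : forall (A B X : C) (g : hom B X) (f : hom A B),
    fmap (ccomp g f) = ccomp (fmap g) (fmap f) }.

Arguments fmap {C D} _ {A B} _.

Record direct_system (C : category) := DirectSystem {
  ds_ix : Type;
  ds_le : ds_ix -> ds_ix -> Prop;
  ds_le_refl : forall i, ds_le i i;
  ds_le_trans : forall j i k, ds_le i j -> ds_le j k -> ds_le i k;
  ds_inhabited : inhabited ds_ix;
  ds_directed : forall i j, exists k, ds_le i k /\ ds_le j k;
  ds_ob : ds_ix -> C;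
  ds_map : forall i j, ds_le i j -> hom (ds_ob i) (ds_ob j);
  ds_map1 : forall i (h : ds_le i i), ds_map h = idm (ds_ob i);
  ds_mapM : forall i j k (hij : ds_le i j) (hjk : ds_le j k) (hik : ds_le i k),
    ds_map hik = ccomp (ds_map hjk) (ds_map hij) }.

Arguments ds_ob {C} d i.
Arguments ds_map {C} d {i j} _.

Definition cocone (C : category) (D : direct_system C) (X : C)
    (f : forall i, hom (ds_ob D i) X) : Prop :=
  forall i j (h : ds_le i j), ccomp (f j) (ds_map D h) = f i.

Definition is_direct_limit (C : category) (D : direct_system C) (L : C)
    (iota : forall i, hom (ds_ob D i) L) : Prop :=
  cocone iota /\
  forall (X : C) (f : forall i, hom (ds_ob D i) X), cocone f ->
    exists! u : hom L X, forall i, ccomp u (iota i) = f i.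

Arguments is_direct_limit {C} D L iota.

Section MapSystem.
Variables (C D : category) (F : functor C D) (S : direct_system C).

Lemma map_system1 (i : ds_ix S) (h : ds_le i i) :
  fmap F (ds_map S h) = idm (F (ds_ob S i)).
Proof. by rewrite ds_map1 fmap1. Qed.

Lemma map_systemM (i j k : ds_ix S)
    (hij : ds_le i j) (hjk : ds_le j k) (hik : ds_le i k) :
  fmap F (ds_map S hik) = ccomp (fmap F (ds_map S hjk)) (fmap F (ds_map S hij)).
Proof. by rewrite -fmapM (ds_mapM hij hjk hik). Qed.

Definition map_system : direct_system D :=
  DirectSystem (@ds_le_refl C S) (@ds_le_trans C S)
    (ds_inhabited S) (@ds_directed C S) map_system1 map_systemM.

End MapSystem.

Record digraph := Digraph {
  vert : Type;
  edge : Type;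
  src : edge -> vert;
  rng : edge -> vert }.

Arguments src {d} _.
Arguments rng {d} _.

(* Sums over finite sets of edges ([fsbigop]) are indexed by a choiceType. *)
HB.instance Definition _ (E : digraph) := gen_eqMixin (edge E).
HB.instance Definition _ (E : digraph) := gen_choiceMixin (edge E).

Section Graphs.
Implicit Types E F G : digraph.

Definition out E (v : vert E) : set (edge E) := src @^-1` [set v].

Definition sink E (v : vert E) : Prop := out v = set0.
Definition infinite_emitter E (v : vert E) : Prop := infinite_set (out v).
Definition regular E (v : vert E) : Prop := ~ sink v /\ ~ infinite_emitter v.

Definition countable_graph E : Prop :=
  countable [set: vert E] /\ countable [set: edge E].

Record graph_mor E F := GraphMor {
  vmap : vert E -> vert F;
  emap : edge E -> edge F;
  src_emap : forall e, src (emap e) = vmap (src e);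
  rng_emap : forall e, rng (emap e) = vmap (rng e) }.

Definition is_CK E F (phi : graph_mor E F) : Prop :=
  [/\ injective (vmap phi), injective (emap phi) &
      forall v, regular v -> set_bij (out v) (out (vmap phi v)) (emap phi)].

Record CK_mor E F := CKMor {
  CK_val :> graph_mor E F;
  CK_valP : is_CK CK_val }.

Lemma CK_mor_eq E F (phi psi : CK_mor E F) :
  vmap phi =1 vmap psi -> emap phi =1 emap psi -> phi = psi.
Proof.
case: phi psi => [[v1 e1 s1 r1] p1] [[v2 e2 s2 r2] p2] /= /funext hv /funext he.
move: s1 r1 p1; rewrite hv he => s1 r1.
rewrite (Prop_irrelevance s1 s2) (Prop_irrelevance r1 r2) => p1.
by rewrite (Prop_irrelevance p1 p2).
Qed.

Lemma graph_id_CK E : is_CK (@GraphMor E E id id (fun=> erefl) (fun=> erefl)).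
Proof.
by split=> // v _; split=> // x hx; exists x.
Qed.

Definition CK_id E : CK_mor E E := CKMor (@graph_id_CK E).

Section Comp.
Variables (E F G : digraph) (psi : graph_mor F G) (phi : graph_mor E F).

Lemma comp_src e : src (emap psi (emap phi e)) = vmap psi (vmap phi (src e)).
Proof. by rewrite !src_emap. Qed.

Lemma comp_rng e : rng (emap psi (emap phi e)) = vmap psi (vmap phi (rng e)).
Proof. by rewrite !rng_emap. Qed.

Definition graph_comp : graph_mor E G :=
  @GraphMor E G (vmap psi \o vmap phi) (emap psi \o emap phi) comp_src comp_rng.

End Comp.

Lemma regular_CK E F (phi : graph_mor E F) v :
  is_CK phi -> regular v -> regular (vmap phi v).
Proof.
case=> _ _ hCK rv; have [phim _ phis] := hCK v rv; case: rv => ns ni; split.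
- apply: contra_not ns => hF; apply/seteqP; split=> // e he.
  by have := phim e he; rewrite hF.
- move=> inf; apply: inf; apply: (sub_finite_set phis).
  by apply: finite_image; apply: contrapT; exact: ni.
Qed.

Lemma graph_comp_CK E F G (psi : CK_mor F G) (phi : CK_mor E F) :
  is_CK (graph_comp psi phi).
Proof.
have [iv ie hE] := CK_valP phi; have [jv je hF] := CK_valP psi.
split; [exact: inj_comp | exact: inj_comp |] => v rv.
exact: (set_bij_comp (hE v rv) (hF _ (regular_CK (CK_valP phi) rv))).
Qed.

Definition CK_comp E F G (psi : CK_mor F G) (phi : CK_mor E F) : CK_mor E G :=
  CKMor (graph_comp_CK psi phi).

Lemma CK_comp1m E F (f : CK_mor E F) : CK_comp (CK_id F) f = f.
Proof. exact: CK_mor_eq. Qed.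

Lemma CK_compm1 E F (f : CK_mor E F) : CK_comp f (CK_id E) = f.
Proof. exact: CK_mor_eq. Qed.

Lemma CK_compA E F G H (h : CK_mor G H) (g : CK_mor F G) (f : CK_mor E F) :
  CK_comp h (CK_comp g f) = CK_comp (CK_comp h g) f.
Proof. exact: CK_mor_eq. Qed.

End Graphs.

Definition CKGr : category := Category CK_comp1m CK_compm1 CK_compA.

Section Subgraphs.
Variable E : digraph.

Record subgraph := Subgraph {
  sub_vert : set (vert E);
  sub_edge : set (edge E);
  sub_src : forall e, sub_edge e -> sub_vert (src e);
  sub_rng : forall e, sub_edge e -> sub_vert (rng e) }.

Implicit Types F G : subgraph.

Definition subgraph_graph F : digraph :=
  @Digraph {x | sub_vert F x} {x | sub_edge F x}
    (fun e => exist _ (src (sval e)) (sub_src (svalP e)))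
    (fun e => exist _ (rng (sval e)) (sub_rng (svalP e))).

Definition subgraph_incl F : graph_mor (subgraph_graph F) E :=
  @GraphMor (subgraph_graph F) E sval sval (fun=> erefl) (fun=> erefl).

Definition subgraph_le F G : Prop :=
  sub_vert F `<=` sub_vert G /\ sub_edge F `<=` sub_edge G.

Section Inclusion.
Variables (F G : subgraph) (h : subgraph_le F G).

Definition le_vmap (x : vert (subgraph_graph F)) : vert (subgraph_graph G) :=
  exist _ (sval x) (h.1 _ (svalP x)).

Definition le_emap (x : edge (subgraph_graph F)) : edge (subgraph_graph G) :=
  exist _ (sval x) (h.2 _ (svalP x)).

Lemma le_src e : src (le_emap e) = le_vmap (src e).
Proof. exact: eq_exist. Qed.

Lemma le_rng e : rng (le_emap e) = le_vmap (rng e).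
Proof. exact: eq_exist. Qed.

Definition subgraph_le_mor : graph_mor (subgraph_graph F) (subgraph_graph G) :=
  GraphMor le_src le_rng.

End Inclusion.

Record countable_CK_subgraph := CountableCKSubgraph {
  ccs_val :> subgraph;
  ccs_CK : is_CK (subgraph_incl ccs_val);
  ccs_countable : countable_graph (subgraph_graph ccs_val) }.

End Subgraphs.

Lemma sval_inj (T : Type) (P : T -> Prop) : injective (@sval T P).
Proof. by move=> [x p] [y q] /= exy; apply: eq_exist. Qed.

Section Countable.
Variable E : digraph.
Implicit Types F G : countable_CK_subgraph E.

Lemma subgraph_outP (F : subgraph E)
    (v : vert (subgraph_graph F)) (e : edge (subgraph_graph F)) :
  out v e <-> out (sval v) (sval e).
Proof. by split=> [<- //|he]; apply: sval_inj. Qed.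

Lemma is_CK_subgraphP (F : subgraph E) :
  is_CK (subgraph_incl F) <->
  forall v : vert (subgraph_graph F), regular v -> out (sval v) `<=` sub_edge F.
Proof.
split=> [[_ _ h] v /h[_ _ hs] e /hs [e' _ <-]|h]; first exact: svalP.
split; [exact: sval_inj|exact: sval_inj|] => v rv; split.
- by move=> e /subgraph_outP.
- by move=> x y _ _ /sval_inj.
- by move=> e he; exists (exist _ e (h v rv e he)) => //; apply/subgraph_outP.
Qed.

Lemma subgraph_le_refl F : subgraph_le F F.
Proof. by split. Qed.

Lemma subgraph_le_trans G F (H : countable_CK_subgraph E) :
  subgraph_le F G -> subgraph_le G H -> subgraph_le F H.
Proof. by move=> [a b] [c d]; split; [apply: subset_trans c|apply: subset_trans d]. Qed.

Lemma subgraph_le_CK F G (h : subgraph_le F G) : is_CK (subgraph_le_mor h).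
Proof.
split; [by move=> x y [] /sval_inj|by move=> x y [] /sval_inj|] => v rv; split.
- by move=> e /subgraph_outP he; apply/subgraph_outP.
- by move=> x y _ _ [] /sval_inj.
- move=> e /subgraph_outP he.
  have he' := (is_CK_subgraphP F).1 (ccs_CK F) v rv _ he.
  exists (exist _ (sval e) he'); last exact: sval_inj.
  exact/subgraph_outP.
Qed.

Definition ccs_incl_le F G (h : subgraph_le F G) :
    hom (subgraph_graph F : CKGr) (subgraph_graph G) :=
  CKMor (subgraph_le_CK h).

Definition ccs_incl F : hom (subgraph_graph F : CKGr) E := CKMor (ccs_CK F).

Lemma ccs_incl_le1 F (h : subgraph_le F F) : ccs_incl_le h = CK_id _.
Proof. by apply: CK_mor_eq => x; apply: sval_inj. Qed.

Lemma ccs_incl_leM F G (H : countable_CK_subgraph E) (hFG : subgraph_le F G)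
    (hGH : subgraph_le G H) (hFH : subgraph_le F H) :
  ccs_incl_le hFH = CK_comp (ccs_incl_le hGH) (ccs_incl_le hFG).
Proof. by apply: CK_mor_eq => x; apply: sval_inj. Qed.

Lemma countable_sig (T : Type) (A : set T) :
  countable [set: {x | A x}] = countable A.
Proof.
rewrite -(eq_countable (inj_card_eq (in2W (@sval_inj T A)))).
congr countable; apply/seteqP; split=> [_ [x _ <-]|x Ax]; first exact: svalP.
by exists (exist _ x Ax).
Qed.

Lemma countable_graphP (F : subgraph E) :
  countable_graph (subgraph_graph F) <->
  countable (sub_vert F) /\ countable (sub_edge F).
Proof. by rewrite /countable_graph !countable_sig. Qed.

Lemma regular_subP (F : subgraph E) (v : vert (subgraph_graph F)) :
  regular v <-> out (sval v) `&` sub_edge F !=set0 /\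
                finite_set (out (sval v) `&` sub_edge F).
Proof.
have eq_out : out (sval v) `&` sub_edge F = sval @` out v.
  apply/seteqP; split=> [e [oe Fe]|_ [e /subgraph_outP oe <-]]; last first.
    by split=> //; exact: svalP.
  by exists (exist _ e Fe) => //; apply/subgraph_outP.
rewrite eq_out.
have inj : {in out v &, injective (@sval _ (sub_edge F))} by move=> x y _ _ /sval_inj.
rewrite (eq_finite_set (inj_card_eq inj)).
rewrite /regular /sink /infinite_emitter notK; split.
  by move=> [/eqP/set0P[e oe] fin]; split=> //; exists (sval e); exists e.
by move=> [[_ [e oe _]] fin]; split=> // o0; rewrite o0 in oe.
Qed.

Lemma empty_src (e : edge E) : (set0 : set (edge E)) e -> (set0 : set (vert E)) (src e).
Proof. by []. Qed.

Lemma empty_rng (e : edge E) : (set0 : set (edge E)) e -> (set0 : set (vert E)) (rng e).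
Proof. by []. Qed.

Lemma ccs_inhabited : inhabited (countable_CK_subgraph E).
Proof.
pose F := Subgraph empty_src empty_rng.
have cF : countable_graph (subgraph_graph F) by exact/countable_graphP.
suff kF : is_CK (subgraph_incl F) by constructor; exact: CountableCKSubgraph kF cF.
by apply/is_CK_subgraphP => -[].
Qed.

Lemma ccs_directed F G :
  exists H : countable_CK_subgraph E, subgraph_le F H /\ subgraph_le G H.
Proof.
pose V := sub_vert F `|` sub_vert G; pose D := sub_edge F `|` sub_edge G.
have sD e : D e -> V (src e) by move=> [/sub_src|/sub_src]; [left|right].
have rD e : D e -> V (rng e) by move=> [/sub_rng|/sub_rng]; [left|right].
pose H := Subgraph sD rD.
have cH : countable_graph (subgraph_graph H).
  have [cF1 cF2] := (countable_graphP F).1 (ccs_countable F).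
  have [cG1 cG2] := (countable_graphP G).1 (ccs_countable G).
  by apply/countable_graphP; split; rewrite /= /V /D -bigcup2E;
    apply: bigcup_countable => // -[|[|]] //= n _; exact: finite_set_countable.
have key (K : countable_CK_subgraph E) e : sub_edge K `<=` D -> sub_edge K e ->
    finite_set (out (src e) `&` D) -> out (src e) `<=` sub_edge K.
  move=> sKD Ke fin; pose v : vert (subgraph_graph K) := exist _ _ (sub_src Ke).
  apply: ((is_CK_subgraphP K).1 (ccs_CK K) v); apply/regular_subP; split.
    by exists e.
  by apply: (sub_finite_set _ fin); exact: setIS.
have kH : is_CK (subgraph_incl H).
  apply/is_CK_subgraphP => v /regular_subP[[e [ev De]] fin] f fv.
  have {fv} fe : out (src e) f by rewrite ev.
  rewrite -ev in fin; case: De => [Fe|Ge].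
    by left; exact: (key F e (@subsetUl _ _ _) Fe fin f fe).
  by right; exact: (key G e (@subsetUr _ _ _) Ge fin f fe).
exists (CountableCKSubgraph kH cH).
by split; split=> x /= ?; [left|left|right|right].
Qed.

Definition countable_CK_system : direct_system CKGr :=
  @DirectSystem CKGr (countable_CK_subgraph E)
    (fun F G => subgraph_le F G) subgraph_le_refl subgraph_le_trans
    ccs_inhabited ccs_directed (fun F => subgraph_graph F) ccs_incl_le
    ccs_incl_le1 ccs_incl_leM.

End Countable.

Record nalgebra (K : fieldType) := NAlgebra {
  nalg :> lmodType K;
  nmul : nalg -> nalg -> nalg;
  nmulA : associative nmul;
  nmul_linearl : forall b, linear (nmul^~ b);
  nmul_linearr : forall a, linear (nmul a) }.

Arguments nmul {K n} _ _ : simpl never.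
Notation "a ** b" := (nmul a b) (at level 40, left associativity) : ring_scope.

Record nalg_mor (K : fieldType) (A B : nalgebra K) := NAlgMor {
  nalg_fun :> A -> B;
  nalg_linear : linear nalg_fun;
  nalg_mul : {morph nalg_fun : x y / x ** y} }.

HB.instance Definition _ (K : fieldType) (A B : nalgebra K) (f : nalg_mor A B) :=
  GRing.isLinear.Build K A B *:%R f (nalg_linear f).

HB.instance Definition _ (K : fieldType) (A : nalgebra K) (a : A) :=
  GRing.isLinear.Build K A A *:%R (nmul a) (nmul_linearr a).

Section NMul.
Variables (K : fieldType) (A : nalgebra K).
Implicit Types a b x y : A.

Lemma nmul0r a : a ** 0 = 0. Proof. exact: (raddf0 (nmul a)). Qed.
Lemma nmulBr a x y : a ** (x - y) = a ** x - a ** y. Proof. exact: (raddfB (nmul a)). Qed.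

Lemma nmulBl b x y : (x - y) ** b = x ** b - y ** b.
Proof. by rewrite addrC -scaleN1r nmul_linearl scaleN1r addrC. Qed.

Lemma nmul0l b : 0 ** b = 0.
Proof. by have := nmulBl b 0 0; rewrite !subrr. Qed.

End NMul.

Lemma nalg_morB (K : fieldType) (A B : nalgebra K) (f : nalg_mor A B) x y :
  f (x - y) = f x - f y.
Proof. exact: linearB. Qed.

Lemma nalg_mor_fsum (K : fieldType) (A B : nalgebra K) (f : nalg_mor A B)
    (I : choiceType) (D : set I) (F : I -> A) : finite_set D ->
  f (\sum_(i \in D) F i) = \sum_(i \in D) f (F i).
Proof. by move=> finD; rewrite !fsbig_finite // linear_sum. Qed.

Section NAlgebraCategory.
Variable K : fieldType.
Implicit Types A B C D : nalgebra K.

Lemma nalg_mor_eq A B (f g : nalg_mor A B) : f =1 g -> f = g.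
Proof.
case: f g => [f l m] [g l' m'] /= /funext e; move: l m; rewrite e => l m.
by rewrite (Prop_irrelevance l l') (Prop_irrelevance m m').
Qed.

Lemma nalg_id_linear A : linear (@id A). Proof. by []. Qed.

Lemma nalg_id_mul A : {morph @id A : x y / x ** y}. Proof. by []. Qed.

Definition nalg_id A : nalg_mor A A := NAlgMor (@nalg_id_linear A) (@nalg_id_mul A).

Section Comp.
Variables (A B C : nalgebra K) (g : nalg_mor B C) (f : nalg_mor A B).

Lemma nalg_comp_linear : linear (g \o f).
Proof. by move=> a x y /=; rewrite !linearP. Qed.

Lemma nalg_comp_mul : {morph g \o f : x y / x ** y}.
Proof. by move=> x y /=; rewrite !nalg_mul. Qed.

Definition nalg_comp : nalg_mor A C := NAlgMor nalg_comp_linear nalg_comp_mul.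

End Comp.

Lemma nalg_comp1m A B (f : nalg_mor A B) : nalg_comp (nalg_id B) f = f.
Proof. exact: nalg_mor_eq. Qed.

Lemma nalg_compm1 A B (f : nalg_mor A B) : nalg_comp f (nalg_id A) = f.
Proof. exact: nalg_mor_eq. Qed.

Lemma nalg_compA A B C D (h : nalg_mor C D) (g : nalg_mor B C) (f : nalg_mor A B) :
  nalg_comp h (nalg_comp g f) = nalg_comp (nalg_comp h g) f.
Proof. exact: nalg_mor_eq. Qed.

Definition NAlg : category := Category nalg_comp1m nalg_compm1 nalg_compA.

Definition is_ideal A (I : set A) : Prop :=
  [/\ I 0, forall c x y, I x -> I y -> I (c *: x + y)
    & forall a x, I x -> I (a ** x) /\ I (x ** a)].

Definition ideal_gen A (R : set A) : set A :=
  [set x | forall I, is_ideal I -> R `<=` I -> I x].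

Lemma ideal_gen_ideal A (R : set A) : is_ideal (ideal_gen R).
Proof.
split=> [I []//|c x y Ix Iy I hI RI|a x Ix].
  by case: (hI) => _ h _; apply: h; [apply: Ix|apply: Iy].
by split=> I hI RI; case: (hI) => _ _ h; have [] := h a x (Ix I hI RI).
Qed.

Lemma ideal_gen_sub A (R : set A) : R `<=` ideal_gen R.
Proof. by move=> x Rx I _; exact. Qed.

End NAlgebraCategory.

Section Quotient.
Variables (K : fieldType) (A : nalgebra K) (R : set A).

Definition ideal_pred : {pred A} := fun x => `[< ideal_gen R x >].

Lemma ideal_predP x : reflect (ideal_gen R x) (x \in ideal_pred).
Proof. exact: asboolP. Qed.

Lemma ideal_pred_zmod : zmod_closed ideal_pred.
Proof.
have [i0 iD _] := ideal_gen_ideal R.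
split=> [|x y /ideal_predP ix /ideal_predP iy]; apply/ideal_predP => //.
by rewrite addrC -scaleN1r; apply: iD.
Qed.

HB.instance Definition _ := GRing.isZmodClosed.Build A ideal_pred ideal_pred_zmod.

Definition quot_alg : Type := Quotient.quot ideal_pred.

HB.instance Definition _ := GRing.Zmodule.on quot_alg.

Definition quot_pi (x : A) : quot_alg := \pi_(Quotient.quot ideal_pred) x.

Lemma quot_piP x y : quot_pi x = quot_pi y <-> ideal_gen R (x - y).
Proof.
split=> [/eqP|h]; last apply/eqP; rewrite -Quotient.idealrBE.
  by move/ideal_predP.
exact/ideal_predP.
Qed.

Lemma quot_pi_surj (q : quot_alg) : exists x, quot_pi x = q.
Proof. by exists (repr q); exact: reprK. Qed.

Lemma quot_piD x y : quot_pi (x + y) = quot_pi x + quot_pi y.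
Proof. exact: raddfD. Qed.

Definition quot_scale (c : K) (q : quot_alg) : quot_alg := quot_pi (c *: repr q).

Definition quot_mul (p q : quot_alg) : quot_alg := quot_pi (repr p ** repr q).

Lemma quot_pi_repr x : ideal_gen R (repr (quot_pi x) - x).
Proof. by apply/quot_piP; exact: reprK. Qed.

Lemma quot_piZ c x : quot_scale c (quot_pi x) = quot_pi (c *: x).
Proof.
apply/quot_piP; rewrite -scalerBr; have [i0 iD _] := ideal_gen_ideal R.
by rewrite -[_ *: _]addr0; apply: iD => //; exact: quot_pi_repr.
Qed.

Lemma quot_piM x y : quot_mul (quot_pi x) (quot_pi y) = quot_pi (x ** y).
Proof.
apply/quot_piP; have [i0 iD iM] := ideal_gen_ideal R.
set x' := repr _; set y' := repr _.
have -> : x' ** y' - x ** y = 1 *: ((x' - x) ** y') + x ** (y' - y).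
  by rewrite scale1r nmulBr nmulBl addrA subrK.
apply: iD; [apply: (iM _ _ _).2|apply: (iM _ _ _).1]; exact: quot_pi_repr.
Qed.

Lemma quot_scaleA a b (v : quot_alg) : quot_scale a (quot_scale b v) = quot_scale (a * b) v.
Proof. by have [x <-] := quot_pi_surj v; rewrite !quot_piZ scalerA. Qed.

Lemma quot_scale1 : left_id 1 quot_scale.
Proof. by move=> v; have [x <-] := quot_pi_surj v; rewrite quot_piZ scale1r. Qed.

Lemma quot_scaleDr : right_distributive quot_scale +%R.
Proof.
move=> c u v; have [x <-] := quot_pi_surj u; have [y <-] := quot_pi_surj v.
by rewrite -quot_piD !quot_piZ scalerDr quot_piD.
Qed.

Lemma quot_scaleDl (v : quot_alg) : {morph quot_scale^~ v : a b / a + b}.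
Proof.
move=> a b; have [x <-] := quot_pi_surj v.
by rewrite !quot_piZ scalerDl quot_piD.
Qed.

HB.instance Definition _ := GRing.Zmodule_isLmodule.Build K quot_alg
  quot_scaleA quot_scale1 quot_scaleDr quot_scaleDl.

Lemma quot_mulA : associative quot_mul.
Proof.
move=> u v w; have [x <-] := quot_pi_surj u; have [y <-] := quot_pi_surj v.
by have [z <-] := quot_pi_surj w; rewrite !quot_piM nmulA.
Qed.

Lemma quot_pi_linear : linear quot_pi.
Proof. by move=> c x y; rewrite quot_piD -quot_piZ. Qed.

Lemma quot_mul_linearl b : linear (quot_mul^~ b).
Proof.
move=> c u v; have [x <-] := quot_pi_surj u; have [y <-] := quot_pi_surj v.
have [z <-] := quot_pi_surj b.
by rewrite -quot_pi_linear !quot_piM -quot_pi_linear nmul_linearl.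
Qed.

Lemma quot_mul_linearr a : linear (quot_mul a).
Proof.
move=> c u v; have [x <-] := quot_pi_surj u; have [y <-] := quot_pi_surj v.
have [z <-] := quot_pi_surj a.
by rewrite -quot_pi_linear !quot_piM -quot_pi_linear nmul_linearr.
Qed.

Definition quot_nalg : nalgebra K :=
  @NAlgebra K quot_alg quot_mul quot_mulA quot_mul_linearl quot_mul_linearr.

Definition quot_proj : nalg_mor A quot_nalg :=
  @NAlgMor K A quot_nalg quot_pi quot_pi_linear (fun x y => esym (quot_piM x y)).

Lemma quot_proj_ker x : quot_proj x = 0 <-> ideal_gen R x.
Proof. by rewrite -(linear0 quot_proj) quot_piP subr0. Qed.

Lemma quot_proj_surj (q : quot_nalg) : exists x, quot_proj x = q.
Proof. exact: quot_pi_surj. Qed.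

Section Lift.
Variables (B : nalgebra K) (f : nalg_mor A B).
Hypothesis fR : forall x, R x -> f x = 0.

Lemma quot_lift_ker x : ideal_gen R x -> f x = 0.
Proof.
move/(_ [set y | f y = 0]); apply; last exact: fR.
split=> [|c y z hy hz|a y hy] /=; first exact: linear0.
  by rewrite nalg_linear hy hz scaler0 addr0.
by rewrite !nalg_mul hy nmul0l nmul0r.
Qed.

Definition quot_lift_fun (q : quot_nalg) : B := f (repr (q : quot_alg)).

Lemma quot_lift_funE x : quot_lift_fun (quot_proj x) = f x.
Proof.
apply/eqP; rewrite -subr_eq0 /quot_lift_fun -linearB; apply/eqP; apply: quot_lift_ker.
exact: quot_pi_repr.
Qed.

Lemma quot_lift_linear : linear quot_lift_fun.
Proof.
move=> c u v; have [x <-] := quot_proj_surj u; have [y <-] := quot_proj_surj v.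
by rewrite -(nalg_linear quot_proj) !quot_lift_funE nalg_linear.
Qed.

Lemma quot_lift_mul : {morph quot_lift_fun : x y / x ** y}.
Proof.
move=> u v; have [x <-] := quot_proj_surj u; have [y <-] := quot_proj_surj v.
by rewrite -(nalg_mul quot_proj) !quot_lift_funE nalg_mul.
Qed.

Definition quot_lift : nalg_mor quot_nalg B := NAlgMor quot_lift_linear quot_lift_mul.

End Lift.
End Quotient.

Arguments quot_proj {K A} R.

Section Paths.
Variable G : digraph.

Fixpoint walk (v : vert G) (s : seq (edge G)) : Prop :=
  if s is e :: s' then src e = v /\ walk (rng e) s' else True.

Definition walk_end (v : vert G) (s : seq (edge G)) : vert G :=
  last v (map rng s).

(* The start vertex is recorded so that there is one path of length zero at
   each vertex. *)
Record gpath := GPath {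
  path_start : vert G;
  path_edges : seq (edge G);
  path_walk : walk path_start path_edges }.

HB.instance Definition _ := gen_eqMixin gpath.
HB.instance Definition _ := gen_choiceMixin gpath.

Definition path_end (p : gpath) : vert G := walk_end (path_start p) (path_edges p).

Lemma path_eq (p q : gpath) :
  path_start p = path_start q -> path_edges p = path_edges q -> p = q.
Proof.
case: p q => [v s w] [v' s' w'] /= ev es; move: w w'; rewrite -ev -es => w w'.
by rewrite (Prop_irrelevance w w').
Qed.

Lemma walk_cat v s t : walk v (s ++ t) <-> walk v s /\ walk (walk_end v s) t.
Proof.
elim: s v => [|e s IH] v /=; first by split=> // -[].
by rewrite IH; split=> [[? []]|[[]]].
Qed.

Lemma walk_end_cat v s t : walk_end v (s ++ t) = walk_end (walk_end v s) t.
Proof. by rewrite /walk_end map_cat last_cat. Qed.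

Lemma pcat_walk (p q : gpath) : path_end p = path_start q ->
  walk (path_start p) (path_edges p ++ path_edges q).
Proof.
by move=> e; apply/walk_cat; split; [|rewrite -/(path_end p) e]; exact: path_walk.
Qed.

Definition pcat (p q : gpath) (h : path_end p = path_start q) : gpath :=
  GPath (pcat_walk h).

Lemma path_end_pcat p q (h : path_end p = path_start q) :
  path_end (pcat h) = path_end q.
Proof. by rewrite /path_end walk_end_cat -/(path_end p) h. Qed.

Definition vpath (v : vert G) : gpath := @GPath v [::] I.

Lemma epath_walk (e : edge G) : walk (src e) [:: e].
Proof. by []. Qed.

Definition epath (e : edge G) : gpath := GPath (epath_walk e).

End Paths.

Section LinearExtension.
Variables (K : fieldType) (T : choiceType) (V : lmodType K).
Implicit Types phi : T -> V.

Definition lin_ext phi (a : {malg K[T]}) : V := \sum_(t <- msupp a) a@_t *: phi t.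

Lemma lin_ext_supp phi a (D : {fset T}) : (msupp a `<=` D)%fset ->
  lin_ext phi a = \sum_(t <- D) a@_t *: phi t.
Proof.
by move=> sD; apply: big_fset_incl => // t _ /mcoeff_outdom ->; rewrite scale0r.
Qed.

Lemma lin_ext_linear phi : linear (lin_ext phi).
Proof.
move=> c a b; pose D := (msupp a `|` msupp b `|` msupp (c *: a + b))%fset.
have sa : (msupp a `<=` D)%fset by rewrite /D -fsetUA fsubsetUl.
have sb : (msupp b `<=` D)%fset by rewrite /D fsetUAC fsubsetUr.
rewrite (lin_ext_supp _ sa) (lin_ext_supp _ sb).
rewrite (lin_ext_supp phi (fsubsetUr _ _ : (_ `<=` D)%fset)).
rewrite scaler_sumr -big_split /=; apply: eq_bigr => t _.
by rewrite mcoeffD mcoeffZ scalerDl scalerA.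
Qed.

Lemma lin_extU phi t : lin_ext phi << t >> = phi t.
Proof.
by rewrite (lin_ext_supp _ msuppU_le) big_seq_fset1 mcoeffUU scale1r.
Qed.

Lemma lin_ext_uniq (f g : {malg K[T]} -> V) : linear f -> linear g ->
  (forall t, f << t >> = g << t >>) -> f =1 g.
Proof.
have key (h : {malg K[T]} -> V) : linear h -> forall a, h a = lin_ext (fun t => h << t >>) a.
  move=> lh a; pose H : {linear {malg K[T]} -> V} :=
    HB.pack h (GRing.isLinear.Build K {malg K[T]} V *:%R h lh).
  rewrite [a in LHS]monalgE -[h]/(H : _ -> _) linear_sum; apply: eq_bigr => t _.
  rewrite -linearZ; congr (H _); apply/malgP => k.
  by rewrite mcoeffZ !mcoeffU mulr_natr.
move=> lf lg fg a; rewrite (key f lf) (key g lg); apply: eq_bigr => t _.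
by rewrite fg.
Qed.

End LinearExtension.

Section PathAlgebra.
Variables (K : fieldType) (G : digraph).
Implicit Types p q r : gpath G.

Definition path_mul p q : {malg K[gpath G]} :=
  if pselect (path_end p = path_start q) is left h then << pcat h >> else 0.

Definition path_alg_mul (a b : {malg K[gpath G]}) : {malg K[gpath G]} :=
  \sum_(p <- msupp a) \sum_(q <- msupp b) (a@_p * b@_q) *: path_mul p q.

Lemma path_mulE p q (h : path_end p = path_start q) :
  path_mul p q = << pcat h >>.
Proof.
rewrite /path_mul; case: pselect => // h'.
by rewrite (Prop_irrelevance h' h).
Qed.

Lemma path_mul0 p q : path_end p <> path_start q -> path_mul p q = 0.
Proof. by rewrite /path_mul; case: pselect. Qed.

Lemma path_alg_mulE a b :
  path_alg_mul a b = lin_ext (fun p => lin_ext (path_mul p) b) a.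
Proof.
rewrite /path_alg_mul /lin_ext; apply: eq_bigr => p _.
by rewrite scaler_sumr; apply: eq_bigr => q _; rewrite scalerA.
Qed.

Lemma path_alg_mul_linearl b : linear (path_alg_mul^~ b).
Proof. by move=> c x y; rewrite !path_alg_mulE lin_ext_linear. Qed.

Lemma path_alg_mul_linearr a : linear (path_alg_mul a).
Proof.
move=> c x y; rewrite !path_alg_mulE /lin_ext scaler_sumr -big_split /=.
apply: eq_bigr => p _; rewrite -/(lin_ext _ _) lin_ext_linear.
by rewrite scalerDr !scalerA mulrC.
Qed.

Lemma path_alg_mulU p q : path_alg_mul << p >> << q >> = path_mul p q.
Proof. by rewrite path_alg_mulE !lin_extU. Qed.

Lemma path_alg_mul0l b : path_alg_mul 0 b = 0.
Proof. by rewrite path_alg_mulE /lin_ext msupp0 big_seq_fset0. Qed.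

Lemma path_alg_mul0r a : path_alg_mul a 0 = 0.
Proof.
by have := path_alg_mul_linearr a (-1) 0 0; rewrite scaler0 addr0 scaleN1r addNr.
Qed.

Lemma path_alg_mulA : associative path_alg_mul.
Proof.
move=> x y z.
have ll := path_alg_mul_linearl; have lr := path_alg_mul_linearr.
apply: (lin_ext_uniq (f := fun x => path_alg_mul x (path_alg_mul y z))
  (g := fun x => path_alg_mul (path_alg_mul x y) z)) => [//||p].
  by move=> c a b; rewrite !ll.
apply: (lin_ext_uniq (f := fun y => path_alg_mul _ (path_alg_mul y z))
  (g := fun y => path_alg_mul (path_alg_mul _ y) z)) => [||q].
- by move=> c a b; rewrite ll lr.
- by move=> c a b; rewrite lr ll.
apply: (lin_ext_uniq (f := fun z => path_alg_mul _ (path_alg_mul _ z))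
  (g := fun z => path_alg_mul (path_alg_mul _ _) z)) => [||r].
- by move=> c a b; rewrite !lr.
- by move=> c a b; rewrite lr.
rewrite !path_alg_mulU.
have [h|h] := pselect (path_end p = path_start q); last first.
  rewrite (path_mul0 h) path_alg_mul0l.
  have [k|k] := pselect (path_end q = path_start r).
    by rewrite (path_mulE k) path_alg_mulU path_mul0.
  by rewrite (path_mul0 k) path_alg_mul0r.
rewrite (path_mulE h) path_alg_mulU.
have [k|k] := pselect (path_end q = path_start r); last first.
  by rewrite (path_mul0 k) path_alg_mul0r path_mul0 // path_end_pcat.
rewrite (path_mulE k) path_alg_mulU.
rewrite (path_mulE (h : path_end p = path_start (pcat k))).
rewrite (path_mulE (etrans (path_end_pcat h) k)).
by congr (<< _ >>); apply: path_eq => //=; rewrite catA.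
Qed.

(* [{malg K[gpath G]}] is the K-vector space with basis the paths [<< p >>]; its
   multiplication extends [path_mul] bilinearly. *)
Definition path_alg : nalgebra K :=
  @NAlgebra K {malg K[gpath G]} path_alg_mul
    path_alg_mulA path_alg_mul_linearl path_alg_mul_linearr.

End PathAlgebra.

Arguments path_mulE {K G p q} h.
Arguments path_mul0 {K G p q} _.

(* [inl e] is the edge [e] and [inr e] the ghost edge [e^*]. *)
Definition double_graph (E : digraph) : digraph :=
  @Digraph (vert E) (edge E + edge E)
    (fun e => match e with inl f => src f | inr f => rng f end)
    (fun e => match e with inl f => rng f | inr f => src f end).

Section Leavitt.
Variables (K : fieldType) (E : digraph).

Definition pvert (v : vert E) : path_alg K (double_graph E) :=
  << (vpath (v : vert (double_graph E))) >>.
Definition preal (e : edge E) : path_alg K (double_graph E) :=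
  << (epath (inl e : edge (double_graph E))) >>.
Definition pghost (e : edge E) : path_alg K (double_graph E) :=
  << (epath (inr e : edge (double_graph E))) >>.

Inductive leavitt_rel : set (path_alg K (double_graph E)) :=
| CK1_eq e : leavitt_rel (pghost e ** preal e - pvert (rng e))
| CK1_neq e f : e <> f -> leavitt_rel (pghost e ** preal f)
| CK2 v : regular v ->
    leavitt_rel (pvert v - \sum_(e \in out v) (preal e ** pghost e)).

Definition leavitt : nalgebra K := quot_nalg leavitt_rel.

Definition lvert (v : vert E) : leavitt := quot_proj leavitt_rel (pvert v).
Definition lreal (e : edge E) : leavitt := quot_proj leavitt_rel (preal e).
Definition lghost (e : edge E) : leavitt := quot_proj leavitt_rel (pghost e).

End Leavitt.

Section LeavittMap.
Variable K : fieldType.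

Section PathMap.
Variables (G H : digraph) (phi : graph_mor G H).
Hypothesis phiI : injective (vmap phi).

Lemma map_walk v s : walk v s -> walk (vmap phi v) (map (emap phi) s).
Proof.
by elim: s v => //= e s IH v [<- /IH]; rewrite src_emap rng_emap.
Qed.

Definition path_map (p : gpath G) : gpath H := GPath (map_walk (path_walk p)).

Lemma path_map_end p : path_end (path_map p) = vmap phi (path_end p).
Proof.
rewrite /path_end /walk_end /= -(last_map (vmap phi)) -!map_comp.
by congr last; apply: eq_map => e /=; rewrite rng_emap.
Qed.

Definition path_alg_fun : path_alg K G -> path_alg K H :=
  lin_ext (fun p => << path_map p >>).

Lemma path_alg_funU p : path_alg_fun << p >> = << path_map p >>.
Proof. exact: lin_extU. Qed.

Lemma path_alg_fun_linear : linear path_alg_fun.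
Proof. exact: lin_ext_linear. Qed.

Lemma path_alg_fun_mul : {morph path_alg_fun : x y / x ** y}.
Proof.
move=> x y; have ll := path_alg_fun_linear.
refine (@lin_ext_uniq K (gpath G) (path_alg K H) (fun x : path_alg K G => path_alg_fun (x ** y))
    (fun x : path_alg K G => path_alg_fun x ** path_alg_fun y) _ _ _ x) => [||p].
- by move=> c a b; rewrite nmul_linearl ll.
- by move=> c a b; rewrite ll nmul_linearl.
refine (@lin_ext_uniq K (gpath G) (path_alg K H) (fun y : path_alg K G => path_alg_fun (_ ** y))
    (fun y : path_alg K G => _ ** path_alg_fun y) _ _ _ y) => [||q].
- by move=> c a b; rewrite nmul_linearr ll.
- by move=> c a b; rewrite ll nmul_linearr.
rewrite !path_alg_funU /nmul /= !path_alg_mulU.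
have [h|h] := pselect (path_end p = path_start q); last first.
  rewrite (path_mul0 h) path_mul0; first by rewrite /path_alg_fun /lin_ext msupp0 big_seq_fset0.
  by rewrite path_map_end => /phiI.
have h' : path_end (path_map p) = path_start (path_map q).
  by rewrite path_map_end h.
rewrite (path_mulE h) (path_mulE h') path_alg_funU.
by congr (<< _ >>); apply: path_eq => //=; rewrite map_cat.
Qed.

Definition path_alg_map : nalg_mor (path_alg K G) (path_alg K H) :=
  NAlgMor path_alg_fun_linear path_alg_fun_mul.

End PathMap.

Section Double.
Variables (E F : digraph) (phi : graph_mor E F).

Definition double_emap (e : edge (double_graph E)) : edge (double_graph F) :=
  match e with inl f => inl (emap phi f) | inr f => inr (emap phi f) end.

Lemma double_src e : src (double_emap e) = vmap phi (src e) :> vert (double_graph F).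
Proof. by case: e => e /=; rewrite ?src_emap ?rng_emap. Qed.

Lemma double_rng e : rng (double_emap e) = vmap phi (rng e) :> vert (double_graph F).
Proof. by case: e => e /=; rewrite ?src_emap ?rng_emap. Qed.

Definition double_mor : graph_mor (double_graph E) (double_graph F) :=
  @GraphMor (double_graph E) (double_graph F) (vmap phi) double_emap double_src double_rng.

End Double.

Section LMap.
Variables (E F : digraph) (phi : CK_mor E F).

Lemma double_inj : injective (vmap (double_mor phi)).
Proof. by case: (CK_valP phi). Qed.

Definition Lpre : nalg_mor (path_alg K (double_graph E)) (leavitt K F) :=
  nalg_comp (quot_proj (@leavitt_rel K F)) (path_alg_map double_inj).

Let quot_proj_path (F : digraph) (p : gpath (double_graph F)) : leavitt K F :=
  quot_proj (@leavitt_rel K F) (<< p >> : {malg K[gpath (double_graph F)]}).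

Lemma Lpre_vert v : Lpre (pvert K v) = lvert K (vmap phi v).
Proof.
rewrite /Lpre /= path_alg_funU; apply: (congr1 (@quot_proj_path F)); apply: path_eq => //=.
Qed.

Lemma Lpre_real e : Lpre (preal K e) = lreal K (emap phi e).
Proof.
rewrite /Lpre /= path_alg_funU; apply: (congr1 (@quot_proj_path F)); apply: path_eq => //=.
by rewrite src_emap.
Qed.

Lemma Lpre_ghost e : Lpre (pghost K e) = lghost K (emap phi e).
Proof.
rewrite /Lpre /= path_alg_funU; apply: (congr1 (@quot_proj_path F)); apply: path_eq => //=.
by rewrite rng_emap.
Qed.

Lemma leavitt_CK1_eq (e : edge F) : lghost K e ** lreal K e = lvert K (rng e).
Proof.
rewrite -nalg_mul; apply/eqP; rewrite -subr_eq0 -linearB; apply/eqP/quot_proj_ker.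
by apply: ideal_gen_sub; exact: CK1_eq.
Qed.

Lemma leavitt_CK1_neq (e f : edge F) : e <> f -> lghost K e ** lreal K f = 0.
Proof.
move=> ef; rewrite -nalg_mul; apply/quot_proj_ker.
by apply: ideal_gen_sub; exact: CK1_neq.
Qed.

Lemma leavitt_CK2 (v : vert F) : regular v ->
  lvert K v = \sum_(e \in out v) (lreal K e ** lghost K e).
Proof.
move=> rv; apply/eqP; rewrite -subr_eq0.
have /quot_proj_ker := ideal_gen_sub (CK2 K rv).
rewrite nalg_morB nalg_mor_fsum; last exact: contrapT rv.2.
move=> h; apply/eqP; rewrite -[RHS]h; congr (_ - _).
by apply: eq_fsbigr => e _; rewrite nalg_mul.
Qed.

Lemma Lpre_rel x : @leavitt_rel K E x -> Lpre x = 0.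
Proof.
case=> [e|e f ef|v rv].
- rewrite nalg_morB nalg_mul Lpre_real Lpre_ghost Lpre_vert leavitt_CK1_eq.
  by rewrite rng_emap subrr.
- rewrite nalg_mul Lpre_real Lpre_ghost leavitt_CK1_neq // => ef'; apply: ef.
  by case: (CK_valP phi) => _ inj _; exact: inj.
- have rv' := regular_CK (CK_valP phi) rv; have [_ _ /(_ v rv) bij] := CK_valP phi.
  rewrite nalg_morB nalg_mor_fsum; last exact: contrapT rv.2.
  rewrite Lpre_vert (leavitt_CK2 rv').
  rewrite (reindex_fsbig (emap phi) (out v)) //.
  apply/eqP; rewrite subr_eq0; apply/eqP; apply: eq_fsbigr => e _.
  by rewrite nalg_mul Lpre_real Lpre_ghost.
Qed.

Definition Lmap : nalg_mor (leavitt K E) (leavitt K F) := quot_lift Lpre_rel.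

Lemma Lmap_vert v : Lmap (lvert K v) = lvert K (vmap phi v).
Proof. by rewrite -Lpre_vert; exact: (quot_lift_funE Lpre_rel). Qed.

Lemma Lmap_real e : Lmap (lreal K e) = lreal K (emap phi e).
Proof. by rewrite -Lpre_real; exact: (quot_lift_funE Lpre_rel). Qed.

Lemma Lmap_ghost e : Lmap (lghost K e) = lghost K (emap phi e).
Proof. by rewrite -Lpre_ghost; exact: (quot_lift_funE Lpre_rel). Qed.

End LMap.

(* The vertices, edges and ghost edges generate the algebra, so that [Lmap phi]
   is determined by its values on them. *)
Lemma leavitt_mor_ext (E : digraph) (B : nalgebra K) (f g : nalg_mor (leavitt K E) B) :
  (forall v, f (lvert K v) = g (lvert K v)) ->
  (forall e, f (lreal K e) = g (lreal K e)) ->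
  (forall e, f (lghost K e) = g (lghost K e)) -> f = g.
Proof.
move=> fv fe fg; apply: nalg_mor_eq => q; have [x <-] := quot_proj_surj q.
pose bas (p : gpath (double_graph E)) : path_alg K (double_graph E) := << p >>.
pose h (u : nalg_mor (leavitt K E) B) := nalg_comp u (quot_proj (@leavitt_rel K E)).
refine (@lin_ext_uniq K _ B (h f) (h g) 
  (nalg_linear (h f)) (nalg_linear (h g)) _ x) => p.
rewrite -/(bas p); case: p => v s w; elim: s v w => [|e s IH] v w.
  by case: w; exact: fv.
have [ev w'] := w.
have -> : bas (GPath w) = bas (epath e) ** bas (@GPath (double_graph E) (rng e) s w').
  have hp : path_end (epath e) = path_start (@GPath (double_graph E) (rng e) s w') by [].
  rewrite [RHS]path_alg_mulU (path_mulE hp).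
  by congr mkmalgU; apply: path_eq.
rewrite !nalg_mul IH; congr (_ ** _).
by case: e {ev w w'} => e; [exact: fe|exact: fg].
Qed.

Lemma Lmap1 (E : digraph) : Lmap (CK_id E) = nalg_id (leavitt K E).
Proof.
by apply: leavitt_mor_ext => x; rewrite ?Lmap_vert ?Lmap_real ?Lmap_ghost.
Qed.

Lemma LmapM (E F G : digraph) (psi : CK_mor F G) (phi : CK_mor E F) :
  Lmap (CK_comp psi phi) = nalg_comp (Lmap psi) (Lmap phi).
Proof.
have compE x : nalg_comp (Lmap psi) (Lmap phi) x = Lmap psi (Lmap phi x) by [].
apply: leavitt_mor_ext => x; rewrite compE.
- by rewrite !Lmap_vert.
- by rewrite !Lmap_real.
- by rewrite !Lmap_ghost.
Qed.

End LeavittMap.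

Definition Leavitt (K : fieldType) : functor CKGr (NAlg K) :=
  @Functor CKGr (NAlg K) (leavitt K) (Lmap K) (Lmap1 K) (LmapM K).

(* Main.v *)
(** Choose for every vertex [v] a countable set [C v] of edges leaving it, equal to
    [out v] when that is finite and infinite otherwise. A countable set of vertices and
    edges closed under endpoints and under [C] is a CK-subgraph, because a vertex
    emitting finitely many of its edges has [C v], hence [out v], finite. So [E] is the
    directed union of its countable CK-subgraphs, and every regular vertex of [E] is
    regular in one of them; compatible maps out of the subgraphs therefore glue to a
    CK-morphism out of [E].

    For [L_K(E)], the images of the vertices, edges and ghost edges glue to families in
    the target algebra. Each defining relation of [L_K(E)] involves generators from a
    single countable CK-subgraph, where it already holds, so the universal property of
    [L_K(E)] gives the mediating morphism. *)

Require Import Defs.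
From mathcomp Require Import all_boot all_algebra.
From mathcomp Require Import finmap.
From mathcomp Require Import boolp classical_sets cardinality fsbigop.
From mathcomp Require Import monalg.

Set Implicit Arguments.
Unset Strict Implicit.
Unset Printing Implicit Defensive.

Import GRing.Theory.
Local Open Scope classical_set_scope.
Local Open Scope ring_scope.

(** * Countable CK-subgraphs containing prescribed vertices and edges *)

Lemma infinite_countable_subset (T : Type) (A : set T) :
  infinite_set A -> exists B, [/\ B `<=` A, countable B & infinite_set B].
Proof.
move=> /infiniteP/card_subP[B BN BA]; exists B; split=> //.
  by rewrite (eq_countable BN); exact: countableP.
by rewrite (eq_finite_set BN); exact: infinite_nat.
Qed.

Section CountableClosure.
Variable E : digraph.

(** At an infinite emitter the last clause is vacuous, because the chosen countable subset is itself
    infinite. *)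
Lemma countable_emission : exists C : vert E -> set (edge E),
  forall v, [/\ C v `<=` out v, countable (C v) & finite_set (C v) -> C v = out v].
Proof.
suff /choice[C hC] : forall v : vert E, exists D : set (edge E),
    [/\ D `<=` out v, countable D & finite_set D -> D = out v] by exists C.
move=> v.
have [fin|inf] := pselect (finite_set (out v)).
  by exists (out v); split=> //; exact: finite_set_countable.
by have [B [BA cB iB]] := infinite_countable_subset inf; exists B; split=> // /iB.
Qed.

Lemma countable_CK_closure (W : set (vert E)) (D : set (edge E)) :
  countable W -> countable D ->
  exists F : countable_CK_subgraph E, W `<=` sub_vert F /\ D `<=` sub_edge F.
Proof.
move=> cW cD; have [C hC] := countable_emission.
(* [X n] collects the vertices reached from [W] and the endpoints of [D] by [n] chosen edges. Only
   ranges are added at each stage, since the source of a chosen edge is already present. *)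
pose X := fix X n := if n is m.+1 then rng @` (\bigcup_(v in X m) C v)
  else W `|` (src @` D `|` rng @` D).
pose V := \bigcup_n X n; pose A := D `|` \bigcup_(v in V) C v.
have cU (T : Type) (P Q : set T) : countable P -> countable Q -> countable (P `|` Q).
  by move=> cP cQ; rewrite -bigcup2E; apply: bigcup_countable => // -[|[|]].
have cI (T U : Type) (f : T -> U) (P : set T) : countable P -> countable (f @` P).
  exact: (sub_countable (card_image_le _ _)).
have cX n : countable (X n).
  elim: n => [|n IH] /=; first by apply: (cU _ _ _ cW); apply: cU; exact: cI.
  by apply: cI; apply: bigcup_countable => // v _; case: (hC v).
have cV : countable V by exact: bigcup_countable.
have cA : countable A.
  by apply: cU => //; apply: bigcup_countable => // v _; case: (hC v).
have sA e : A e -> V (src e).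
  case=> [De|[v Vv Cve]]; first by exists 0%N => //=; right; left; exists e.
  by have [/(_ e Cve) ev _ _] := hC v; rewrite (ev : src e = v).
have rA e : A e -> V (rng e).
  case=> [De|[v [n _ Xv] Cve]]; first by exists 0%N => //=; right; right; exists e.
  by exists n.+1 => //=; exists e => //; exists v.
pose F := Subgraph sA rA.
have kF : is_CK (subgraph_incl F).
  apply/is_CK_subgraphP => v /regular_subP[_ fin].
  have CA : C (sval v) `<=` A by move=> e Ce; right; exists (sval v) => //; exact: svalP v.
  (* If only finitely many edges of [A] leave this vertex, its chosen set is finite, hence equal to
     the whole of [out (sval v)], and it lies in [A]. *)
  have [CO _ Cfin] := hC (sval v).
  by rewrite -Cfin //; apply: (sub_finite_set _ fin) => e Ce; split; [exact: CO|exact: CA].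
exists (CountableCKSubgraph kF ((countable_graphP F).2 (conj cV cA))).
by split=> x; [exists 0%N => //=; left|left].
Qed.

Lemma countable_CK_vert (v : vert E) : exists F : countable_CK_subgraph E, sub_vert F v.
Proof.
have [F [h _]] := countable_CK_closure (finite_set_countable (finite_set1 v)) (countable0 (edge E)).
by exists F; exact: h.
Qed.

Lemma countable_CK_edge (e : edge E) : exists F : countable_CK_subgraph E, sub_edge F e.
Proof.
have [F [_ h]] := countable_CK_closure (countable0 (vert E)) (finite_set_countable (finite_set1 e)).
by exists F; exact: h.
Qed.

(** A regular vertex of [E] may become a sink in [F]. The edge [e] excludes this, and finite
    emission passes to subsets. *)
Lemma regular_in_ccs (F : countable_CK_subgraph E) (v : vert (subgraph_graph F))
  (e : edge E) : sub_edge F e -> out (sval v) e -> regular (sval v) -> regular v.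
Proof.
move=> Fe ve [_ fin]; apply/regular_subP; split; first by exists e.
by apply: (sub_finite_set (@subIsetl _ _ _)); exact: contrapT.
Qed.

Lemma regular_vert_ccs (v : vert E) : regular v ->
  exists (F : countable_CK_subgraph E) (x : vert (subgraph_graph F)),
  sval x = v /\ regular x.
Proof.
move=> rv; have /eqP/set0P[e ev] := rv.1; have [F Fe] := countable_CK_edge e.
exists F, (src (exist _ e Fe : edge (subgraph_graph F))); split=> //.
by apply: (regular_in_ccs Fe) => //=; rewrite ev.
Qed.

(** * Gluing compatible families over the countable CK-subgraphs *)

(** Directedness makes the value at [x] independent of the subgraph: two subgraphs whose sets
    contain [x] lie below a third, where both values agree with its own. The parameter [S] covers
    vertices and edges alike. *)
Lemma ccs_glue (U T : Type) (S : countable_CK_subgraph E -> set U)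
    (h : forall F, {x | S F x} -> T) :
  (forall x, exists F, S F x) ->
  (forall (F G : countable_CK_subgraph E), subgraph_le F G -> S F `<=` S G) ->
  (forall (F G : countable_CK_subgraph E) x y, subgraph_le F G ->
     sval x = sval y -> h F x = h G y) ->
  exists u : U -> T, forall F x, u (sval x) = h F x.
Proof.
move=> cover mono hh.
suff /choice[u hu] : forall x, exists y : T, forall F (k : S F x), y = h F (exist _ x k).
  by exists u => F [x k]; exact: hu.
move=> x; have [F Fx] := cover x; exists (h F (exist _ x Fx)) => G Gx.
have [H [FH GH]] := ccs_directed F G; have Hx := mono F H FH x Fx.
by rewrite (hh F H _ (exist _ x Hx)) // (hh G H _ (exist _ x Hx)).
Qed.

Lemma ccs_glue_vert (T : Type)
    (h : forall F : countable_CK_subgraph E, vert (subgraph_graph F) -> T) :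
  (forall (F G : countable_CK_subgraph E) (l : subgraph_le F G) x,
     h G (le_vmap l x) = h F x) ->
  exists u : vert E -> T, forall F x, u (sval x) = h F x.
Proof.
move=> hh; apply: ccs_glue => [v|F G []|F G x y l xy] //; first exact: countable_CK_vert.
by rewrite -(hh F G l); congr (h G _); exact: sval_inj.
Qed.

Lemma ccs_glue_edge (T : Type)
    (h : forall F : countable_CK_subgraph E, edge (subgraph_graph F) -> T) :
  (forall (F G : countable_CK_subgraph E) (l : subgraph_le F G) x,
     h G (le_emap l x) = h F x) ->
  exists u : edge E -> T, forall F x, u (sval x) = h F x.
Proof.
move=> hh; apply: ccs_glue => [e|F G []|F G x y l xy] //; first exact: countable_CK_edge.
by rewrite -(hh F G l); congr (h G _); exact: sval_inj.
Qed.

Lemma common_ccs (F G : countable_CK_subgraph E) : exists H : countable_CK_subgraph E,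
  (sub_vert F `|` sub_vert G `<=` sub_vert H) /\
  (sub_edge F `|` sub_edge G `<=` sub_edge H).
Proof.
have [H [[a b] [c d]]] := ccs_directed F G.
by exists H; split; rewrite subUset.
Qed.

(** Injectivity and orthogonality compare two vertices, so both must lie in one subgraph. Statements
    about a single vertex use the case [v = w]. *)
Lemma vert2_ccs (v w : vert E) : exists (F : countable_CK_subgraph E)
  (x y : vert (subgraph_graph F)), sval x = v /\ sval y = w.
Proof.
have [F Fv] := countable_CK_vert v; have [G Gw] := countable_CK_vert w.
have [H [h _]] := common_ccs F G.
by exists H, (exist _ v (h _ (or_introl Fv))), (exist _ w (h _ (or_intror Gw))).
Qed.

Lemma edge2_ccs (e f : edge E) : exists (F : countable_CK_subgraph E)
  (x y : edge (subgraph_graph F)), sval x = e /\ sval y = f.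
Proof.
have [F Fe] := countable_CK_edge e; have [G Gf] := countable_CK_edge f.
have [H [_ h]] := common_ccs F G.
by exists H, (exist _ e (h _ (or_introl Fe))), (exist _ f (h _ (or_intror Gf))).
Qed.

End CountableClosure.

(** * The graph [E] as a direct limit in [CKGr] *)

Lemma ccs_direct_limit (E : digraph) :
  is_direct_limit (countable_CK_system E) E (@ccs_incl E).
Proof.
split=> [F G h|X f fc]; first by apply: CK_mor_eq.
pose g (F : countable_CK_subgraph E) : CK_mor (subgraph_graph F) X := f F.
have gc (F G : countable_CK_subgraph E) (l : subgraph_le F G) :
  CK_comp (g G) (ccs_incl_le l) = g F := fc F G l.
have [uv huv] : exists u : vert E -> vert X, forall F x, u (sval x) = vmap (g F) x.
  by apply: ccs_glue_vert => F G l x; rewrite -(gc F G l).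
have [ue hue] : exists u : edge E -> edge X, forall F x, u (sval x) = emap (g F) x.
  by apply: ccs_glue_edge => F G l x; rewrite -(gc F G l).
have us e : src (ue e) = uv (src e).
  have [F [x [_ [<- _]]]] := edge2_ccs e e.
  by rewrite hue src_emap -huv.
have ur e : rng (ue e) = uv (rng e).
  have [F [x [_ [<- _]]]] := edge2_ccs e e.
  by rewrite hue rng_emap -huv.
have uCK : is_CK (GraphMor us ur).
  split=> [v w|e e'|v rv] /=.
  - have [F [x [y [<- <-]]]] := vert2_ccs v w; rewrite !huv.
    by have [inj _ _] := CK_valP (g F) => /inj ->.
  - have [F [x [y [<- <-]]]] := edge2_ccs e e'; rewrite !hue.
    by have [_ inj _] := CK_valP (g F) => /inj ->.
  (* Since [x] is regular in [F], the inclusion maps [out x] onto all of [out v] ([ib]), so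
     bijectivity of the glued edge map there follows from that of [g F] ([fb]). *)
  - have [F [x [xv rx]]] := regular_vert_ccs rv; rewrite -xv huv.
    have [_ _ /(_ x rx) fb] := CK_valP (g F).
    have [_ _ /(_ x rx) ib] := ccs_CK F.
    split.
    + move=> e xe; have [_ _ /(_ e xe)[e' xe' <-]] := ib.
      by rewrite hue; case: fb => + _ _; apply.
    + move=> e e' /set_mem xe /set_mem xe'; have [_ _ si] := ib.
      have [d xd <-] := si e xe; have [d' xd' <-] := si e' xe'.
      rewrite !hue => de; congr (emap _ _); case: fb => _ + _.
      by apply=> //; exact: mem_set.
    + move=> e' xe'; have [_ _ /(_ e' xe')[e xe <-]] := fb.
      by exists (sval e); [apply/subgraph_outP|rewrite hue].
exists (CKMor uCK); split=> [F|u' hu'].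
  by apply: CK_mor_eq => x /=; [exact: huv|exact: hue].
apply: CK_mor_eq => x /=.
  have [F [y [_ [<- _]]]] := vert2_ccs x x; by rewrite huv /g -(hu' F).
have [F [y [_ [<- _]]]] := edge2_ccs x x; by rewrite hue /g -(hu' F).
Qed.

(** * Universal property of the path algebra *)

Section PathAlgebraLift.
Variables (K : fieldType) (G : digraph) (B : nalgebra K).
Variables (p : vert G -> B) (s : edge G -> B).
Hypothesis p_idem : forall v, p v ** p v = p v.
Hypothesis p_ortho : forall v w, v <> w -> p v ** p w = 0.
Hypothesis p_src : forall e, p (src e) ** s e = s e.
Hypothesis p_rng : forall e, s e ** p (rng e) = s e.

(** The product carries a final factor [p] at the end vertex, so that empty walks need no separate
    treatment; [p_rng] absorbs this factor after an edge. *)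
Fixpoint walk_val (v : vert G) (w : seq (edge G)) : B :=
  if w is e :: w' then s e ** walk_val (rng e) w' else p v.

Lemma walk_val_start v w : walk v w -> p v ** walk_val v w = walk_val v w.
Proof. by case: w => [|e w] /= => [_|[<- _]]; rewrite ?nmulA ?p_src. Qed.

Lemma walk_val_cat v w v' w' : walk v w -> walk v' w' ->
  walk_end v w = v' -> walk_val v w ** walk_val v' w' = walk_val v (w ++ w').
Proof.
move=> + hw'; elim: w v => [|e w IH] v /=.
  by rewrite /walk_end /= => _ ->; exact: walk_val_start.
by move=> [_ hw] hv; rewrite -nmulA IH.
Qed.

(** The final factor of the first product meets the factor [p v'] that [walk_val_start] puts in
    front of the second, and [p_ortho] kills their product. *)
Lemma walk_val_ortho v w v' w' : walk v w -> walk v' w' ->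
  walk_end v w <> v' -> walk_val v w ** walk_val v' w' = 0.
Proof.
move=> + hw'; elim: w v => [|e w IH] v /=.
  by rewrite /walk_end /= => _ h; rewrite -walk_val_start // nmulA p_ortho // nmul0l.
by move=> [_ hw] hv; rewrite -nmulA IH // nmul0r.
Qed.

Definition path_val (x : gpath G) : B := walk_val (path_start x) (path_edges x).

Lemma path_alg_lift : exists u : nalg_mor (path_alg K G) B,
  (forall v, u (<< vpath v >> : {malg K[gpath G]}) = p v) /\
  (forall e, u (<< epath e >> : {malg K[gpath G]}) = s e).
Proof.
pose u : path_alg K G -> B := lin_ext path_val.
have ul : linear u := lin_ext_linear path_val.
have uM : {morph u : x y / x ** y}.
  (* Both sides are linear in each variable, which reduces multiplicativity to two basis paths [a]
     and [b]. *)
  move=> x y; refine (@lin_ext_uniq K (gpath G) B (fun x : path_alg K G => u (x ** y))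
    (fun x : path_alg K G => u x ** u y) _ _ _ x) => [||a].
  - by move=> c a b; rewrite nmul_linearl ul.
  - by move=> c a b; rewrite ul nmul_linearl.
  refine (@lin_ext_uniq K (gpath G) B (fun y : path_alg K G => u (_ ** y))
    (fun y : path_alg K G => _ ** u y) _ _ _ y) => [||b].
  - by move=> c d b; rewrite nmul_linearr ul.
  - by move=> c d b; rewrite ul nmul_linearr.
  rewrite [X in u X]path_alg_mulU /u !lin_extU.
  have [h|h] := pselect (path_end a = path_start b).
    by rewrite (path_mulE h) lin_extU /path_val walk_val_cat //; exact: path_walk.
  rewrite (path_mul0 h) /path_val walk_val_ortho //; try exact: path_walk.
  by rewrite /lin_ext msupp0 big_seq_fset0.
exists (NAlgMor ul uM); split=> [v|e]; first exact: lin_extU.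
by rewrite /= /u lin_extU /path_val /= p_rng.
Qed.

End PathAlgebraLift.

(** * Universal property of the Leavitt path algebra *)

Section LeavittLift.
Variables (K : fieldType) (E : digraph).

Lemma lvert_idem (v : vert E) : lvert K v ** lvert K v = lvert K v.
Proof.
have h : path_end (vpath (v : vert (double_graph E))) =
  path_start (vpath (v : vert (double_graph E))) by [].
rewrite -nalg_mul; congr (quot_proj _ _).
by rewrite [LHS]path_alg_mulU (path_mulE h); congr mkmalgU; apply: path_eq.
Qed.

Lemma lvert_ortho (v w : vert E) : v <> w -> lvert K v ** lvert K w = 0.
Proof.
move=> vw; rewrite -nalg_mul -(linear0 (quot_proj _)); congr (quot_proj _ _).
by rewrite [LHS]path_alg_mulU path_mul0.
Qed.

(** Handles real and ghost edges together; the cases [inl] and [inr] give the four absorption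
    identities below. *)
Let ledge (d : edge (double_graph E)) : leavitt K E :=
  quot_proj (@leavitt_rel K E) (<< epath d >> : {malg K[gpath (double_graph E)]}).

Lemma lvert_ledge (d : edge (double_graph E)) : @lvert K E (src d) ** ledge d = ledge d.
Proof.
have h : path_end (vpath (src d)) = path_start (epath d) by [].
rewrite -nalg_mul; congr (quot_proj _ _).
by rewrite [LHS]path_alg_mulU (path_mulE h); congr mkmalgU; apply: path_eq.
Qed.

Lemma ledge_lvert (d : edge (double_graph E)) : ledge d ** @lvert K E (rng d) = ledge d.
Proof.
have h : path_end (epath d) = path_start (vpath (rng d)) by [].
rewrite -nalg_mul; congr (quot_proj _ _).
by rewrite [LHS]path_alg_mulU (path_mulE h); congr mkmalgU; apply: path_eq.
Qed.

Lemma lvert_lreal (e : edge E) : lvert K (src e) ** lreal K e = lreal K e.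
Proof. exact: (lvert_ledge (inl e)). Qed.

Lemma lreal_lvert (e : edge E) : lreal K e ** lvert K (rng e) = lreal K e.
Proof. exact: (ledge_lvert (inl e)). Qed.

Lemma lvert_lghost (e : edge E) : lvert K (rng e) ** lghost K e = lghost K e.
Proof. exact: (lvert_ledge (inr e)). Qed.

Lemma lghost_lvert (e : edge E) : lghost K e ** lvert K (src e) = lghost K e.
Proof. exact: (ledge_lvert (inr e)). Qed.

Variables (B : nalgebra K) (p : vert E -> B) (s t : edge E -> B).
Hypothesis p_idem : forall v, p v ** p v = p v.
Hypothesis p_ortho : forall v w, v <> w -> p v ** p w = 0.
Hypothesis p_src_s : forall e, p (src e) ** s e = s e.
Hypothesis s_p_rng : forall e, s e ** p (rng e) = s e.
Hypothesis p_rng_t : forall e, p (rng e) ** t e = t e.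
Hypothesis t_p_src : forall e, t e ** p (src e) = t e.
Hypothesis CK1_eq_st : forall e, t e ** s e = p (rng e).
Hypothesis CK1_neq_st : forall e f, e <> f -> t e ** s f = 0.
Hypothesis CK2_st : forall v, regular v -> p v = \sum_(e \in out v) (s e ** t e).

Lemma leavitt_lift : exists u : nalg_mor (leavitt K E) B,
  [/\ forall v, u (lvert K v) = p v, forall e, u (lreal K e) = s e
    & forall e, u (lghost K e) = t e].
Proof.
(* Ghost edges swap source and range, so the four absorption hypotheses on [s] and [t] become the
   two that [path_alg_lift] requires of [d]. *)
pose d (x : edge (double_graph E)) := match x with inl e => s e | inr e => t e end.
have d_src (x : edge (double_graph E)) : p (src x) ** d x = d x by case: x.
have d_rng (x : edge (double_graph E)) : d x ** p (rng x) = d x by case: x.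
have [w [wv we]] := @path_alg_lift K (double_graph E) B p d p_idem p_ortho d_src d_rng.
have wr e : w (preal K e) = s e := we (inl e).
have wg e : w (pghost K e) = t e := we (inr e).
have wR x : leavitt_rel x -> w x = 0.
  case=> [e|e f ef|v rv].
  - by rewrite nalg_morB nalg_mul wr wg [w (pvert _ _)]wv CK1_eq_st subrr.
  - by rewrite nalg_mul wr wg CK1_neq_st.
  - rewrite nalg_morB nalg_mor_fsum; last exact: contrapT rv.2.
    rewrite [w (pvert _ _)]wv CK2_st //; apply/eqP; rewrite subr_eq0; apply/eqP.
    by apply: eq_fsbigr => e _; rewrite nalg_mul wr wg.
exists (quot_lift wR); split=> x; rewrite [LHS](quot_lift_funE wR).
- exact: wv.
- exact: wr.
- exact: wg.
Qed.

End LeavittLift.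

(** * The algebra of [E] as a direct limit in [NAlg K] *)

Lemma leavitt_ccs_direct_limit (E : digraph) (K : fieldType) :
  is_direct_limit (map_system (Leavitt K) (countable_CK_system E))
    (Leavitt K E) (fun F => fmap (Leavitt K) (ccs_incl F)).
Proof.
split=> [F G h|B f fc].
  rewrite /= -LmapM; congr (Lmap K _); exact: CK_mor_eq.
pose g (F : countable_CK_subgraph E) : nalg_mor (leavitt K (subgraph_graph F)) B := f F.
have gc (F G : countable_CK_subgraph E) (l : subgraph_le F G) x :
    g G (Lmap K (ccs_incl_le l) x) = g F x.
  exact: (congr1 (fun k : nalg_mor _ _ => k x) (fc F G l)).
have [p hp] : exists u : vert E -> B, forall (F : countable_CK_subgraph E) (x : vert (subgraph_graph F)),
    u (sval x) = g F (lvert K x).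
  by apply: ccs_glue_vert => F G l x; rewrite -(gc F G l) Lmap_vert.
have [s hs] : exists u : edge E -> B, forall (F : countable_CK_subgraph E) (x : edge (subgraph_graph F)),
    u (sval x) = g F (lreal K x).
  by apply: ccs_glue_edge => F G l x; rewrite -(gc F G l) Lmap_real.
have [t ht] : exists u : edge E -> B, forall (F : countable_CK_subgraph E) (x : edge (subgraph_graph F)),
    u (sval x) = g F (lghost K x).
  by apply: ccs_glue_edge => F G l x; rewrite -(gc F G l) Lmap_ghost.
have hsrc (F : countable_CK_subgraph E) (x : edge (subgraph_graph F)) : p (src (sval x)) = g F (lvert K (src x)).
  by rewrite -hp.
have hrng (F : countable_CK_subgraph E) (x : edge (subgraph_graph F)) : p (rng (sval x)) = g F (lvert K (rng x)).
  by rewrite -hp.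
have [u [uv us ut]] : exists u : nalg_mor (leavitt K E) B,
  [/\ forall v, u (lvert K v) = p v, forall e, u (lreal K e) = s e
    & forall e, u (lghost K e) = t e].
  apply: leavitt_lift => [v|v w|e|e|e|e|e|e e'|v rv].
  - by have [F [x [_ [<- _]]]] := vert2_ccs v v; rewrite hp -nalg_mul lvert_idem.
  - have [F [x [y [<- <-]]]] := vert2_ccs v w => xy.
    rewrite !hp -nalg_mul lvert_ortho ?linear0 // => exy; exact: xy (congr1 sval exy).
  - by have [F [x [_ [<- _]]]] := edge2_ccs e e; rewrite hsrc hs -nalg_mul lvert_lreal.
  - by have [F [x [_ [<- _]]]] := edge2_ccs e e; rewrite hrng hs -nalg_mul lreal_lvert.
  - by have [F [x [_ [<- _]]]] := edge2_ccs e e; rewrite hrng ht -nalg_mul lvert_lghost.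
  - by have [F [x [_ [<- _]]]] := edge2_ccs e e; rewrite hsrc ht -nalg_mul lghost_lvert.
  - have [F [x [_ [<- _]]]] := edge2_ccs e e.
    by rewrite hrng hs ht -nalg_mul leavitt_CK1_eq.
  - have [F [x [y [<- <-]]]] := edge2_ccs e e' => xy.
    rewrite hs ht -nalg_mul leavitt_CK1_neq ?linear0 // => exy; exact: xy (congr1 sval exy).
  - have [F [x [xv rx]]] := regular_vert_ccs rv.
    (* The second Cuntz-Krieger relation holds at [x] in the algebra of [F]; its sum is reindexed
       along the bijection from [out x] to [out v] given by the inclusion. *)
    have [_ _ /(_ x rx) ib] := ccs_CK F; rewrite -xv.
    rewrite hp (leavitt_CK2 K rx) nalg_mor_fsum; last exact: contrapT rx.2.
    rewrite (reindex_fsbig (emap (subgraph_incl F)) (out x)) //.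
    by apply: eq_fsbigr => e _; rewrite hs ht nalg_mul.
exists u; split=> [F|u' hu'].
  apply: leavitt_mor_ext => x; apply: (etrans (_ : _ = u (Lmap K (ccs_incl F) _))) => //.
  - by rewrite Lmap_vert uv hp.
  - by rewrite Lmap_real us hs.
  - by rewrite Lmap_ghost ut ht.
have u'E (F : countable_CK_subgraph E) x : (u' : nalg_mor _ _) (Lmap K (ccs_incl F) x) = g F x.
  exact: (congr1 (fun k : nalg_mor _ _ => k x) (hu' F)).
(* Uniqueness: each generator of the algebra of [E] comes from some [F], where [u'] is forced to
   agree with [g F]. *)
apply: leavitt_mor_ext => x.
- by have [F [y [_ [<- _]]]] := vert2_ccs x x; rewrite uv hp -u'E Lmap_vert.
- by have [F [y [_ [<- _]]]] := edge2_ccs x x; rewrite us hs -u'E Lmap_real.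
- by have [F [y [_ [<- _]]]] := edge2_ccs x x; rewrite ut ht -u'E Lmap_ghost.
Qed.

Theorem proposition2p7 (E : digraph) (K : fieldType) :
  is_direct_limit (countable_CK_system E) E (@ccs_incl E) /\
  is_direct_limit (map_system (Leavitt K) (countable_CK_system E))
    (Leavitt K E) (fun F => fmap (Leavitt K) (ccs_incl F)).
Proof. by split; [exact: ccs_direct_limit|exact: leavitt_ccs_direct_limit]. Qed.
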